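(* For every natural number $k$, there exists a lattice $3$-simplex $P=P(k)\subset\mathbb{R}^3$ such that the affine semigroup $Q_P$ is not normal, and every hole $q\in \overline{Q}_P\setminus Q_P$ satisfies $\sigma_F(q)\ge k$ for every facet $F$ of $Q_P$.
   Context: A lattice polytope $P\subset\mathbb{R}^n$ is a polytope with vertices in $\mathbb{Z}^n$. Its associated affine semigroup $Q_P\subset\mathbb{Z}^{n+1}$ is the semigroup generated by $\{(p,1): p\in P\cap\mathbb{Z}^n\}$. Let $\mathbb{Z}Q_P$ be the group generated by $Q_P$ and $\overline{Q}_P=\mathbb{Z}Q_P\cap\mathbb{R}_{\ge0}Q_P$ its normalization; $Q_P$ is normal if $Q_P=\overline{Q}_P$. A hole is an element of $\overline{Q}_P\setminus Q_P$. The facets of $Q_P$ are the facets of the cone $\mathbb{R}_{\ge0}Q_P$. For a facet $F$, the lattice height $\sigma_F:\mathbb{Z}Q_P\to\mathbb{Z}$ is the linear form with $\sigma_F(F)=0$ and $\sigma_F(\overline{Q}_P)=\mathbb{Z}_{\ge0}$. *)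

(* Defs.v *)
From HB Require Import structures.
From mathcomp Require Import all_boot all_order all_algebra.
From mathcomp Require Import boolp classical_sets functions reals.

Set Implicit Arguments.
Unset Strict Implicit.
Unset Printing Implicit Defensive.

Import Order.TTheory GRing.Theory Num.Theory.

Local Open Scope classical_set_scope.
Local Open Scope ring_scope.

Section Convexity.
Variables (R : realType) (n : nat).
Local Notation E := 'rV[R]_n.

Definition conv_hull (V : set E) : set E :=
  [set x | exists m (v : 'I_m -> E) (c : 'I_m -> R),
    [/\ forall i, V (v i), forall i, 0 <= c i, \sum_i c i = 1
      & x = \sum_i c i *: v i]].

Definition cone_hull (V : set E) : set E :=
  [set x | exists m (v : 'I_m -> E) (c : 'I_m -> R),
    [/\ forall i, V (v i), forall i, 0 <= c i & x = \sum_i c i *: v i]].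

Definition affinely_independent m (v : 'I_m -> E) : Prop :=
  forall c : 'I_m -> R,
    \sum_i c i = 0 -> \sum_i c i *: v i = 0 -> forall i, c i = 0.

(* [S] is nonempty and its affine span has dimension [d]. *)
Definition has_dim (S : set E) (d : nat) : Prop :=
  (exists v : 'I_d.+1 -> E, affinely_independent v /\ forall i, S (v i)) /\
  ~ (exists v : 'I_d.+2 -> E, affinely_independent v /\ forall i, S (v i)).

(* Faces are cut out by valid linear inequalities [b <= x *m l]; the empty
   face and the whole set are included. *)
Definition face (C F : set E) : Prop :=
  exists (l : 'cV[R]_n) (b : R),
    (forall x, C x -> b <= (x *m l) 0 0) /\
    F = [set x | C x /\ (x *m l) 0 0 = b].

Definition facet (C F : set E) : Prop :=
  face C F /\ exists d, has_dim F d /\ has_dim C d.+1.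

Definition vertex (P : set E) (x : E) : Prop := face P [set x].

Definition polytope (P : set E) : Prop :=
  exists m (v : 'I_m -> E), P = conv_hull (range v).

Definition simplex (d : nat) (P : set E) : Prop :=
  exists v : 'I_d.+1 -> E, affinely_independent v /\ P = conv_hull (range v).

Definition real_point (p : 'rV[int]_n) : E := map_mx intr p.

Definition lattice_polytope (P : set E) : Prop :=
  polytope P /\ vertex P `<=` range real_point.

End Convexity.

Section GeneratedSubsets.
Variable V : zmodType.

Definition submonoid (S : set V) : Prop :=
  S 0 /\ forall x y, S x -> S y -> S (x + y).

Definition subgroup (S : set V) : Prop :=
  S 0 /\ forall x y, S x -> S y -> S (x - y).

End GeneratedSubsets.

Section PolytopeSemigroup.
Variables (R : realType) (n : nat) (P : set 'rV[R]_n).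
Local Notation L := 'rV[int]_(n + 1).

(* Affine semigroups contain 0. *)
Definition semigroup_of : set L :=
  smallest (@submonoid L)
    [set row_mx p (1 : 'rV[int]_1) | p in [set p | P (real_point R p)]].

Definition group_of : set L := smallest (@subgroup L) semigroup_of.

Definition cone_of : set 'rV[R]_(n + 1) :=
  cone_hull (@real_point R _ @` semigroup_of).

Definition normalization : set L :=
  [set q | group_of q /\ cone_of (real_point R q)].

Definition normal_semigroup : Prop := semigroup_of = normalization.

Definition hole (q : L) : Prop := normalization q /\ ~ semigroup_of q.

Definition semigroup_facet (F : set 'rV[R]_(n + 1)) : Prop := facet cone_of F.

(* Only the restriction of [s] to [group_of] is relevant. *)
Definition is_lattice_height (F : set 'rV[R]_(n + 1)) (s : L -> int) : Prop :=
  [/\ forall x y, group_of x -> group_of y -> s (x + y) = s x + s y,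
      forall x, group_of x -> F (real_point R x) -> s x = 0
    & s @` normalization = [set z | 0 <= z]].

(* For a facet [F] such a form exists and is unique on [group_of]; the zero
   function is the junk value when there is none. *)
Definition lattice_height (F : set 'rV[R]_(n + 1)) : L -> int :=
  xget (fun=> 0) [set s | is_lattice_height F s].

End PolytopeSemigroup.

(* Main.v *)
Require Import Defs.
From mathcomp Require Import all_boot all_order all_algebra.
From mathcomp Require Import boolp classical_sets functions reals.
From mathcomp Require Import zify ring lra.

(** The simplex is a join of a lattice edge of length 3 and one of length 1.
    Write its cone points as [(a, b, e, h)], with [h] the degree.
    In terms of [u = a + 4 m b] and [s = a + 2 e], the lattice is
    [{(a, u, s, h) | u = a mod 4 m, s = a mod 2}] and the cone is
    [0 <= u <= 2 m s], [0 <= a <= 6 m (2 h - s)].  At [h = 1] the lattice points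
    are the multiples of [4 m] on the two edges [s = 0] (in [a]) and [s = 2]
    (in [u]), and in the middle slice [s = 1] the points whose residue modulo
    [4 m] is an odd number below [2 m].  Hence two middle points produce every
    even residue and three produce every odd one; an element fails to decompose
    only if its residue exceeds [2 m], [s] is odd and there is room for a single
    middle point.  Such elements exist, and all four facet heights of each of
    them exceed [2 m]. *)

Set Implicit Arguments.
Unset Strict Implicit.
Unset Printing Implicit Defensive.

Import Order.TTheory GRing.Theory Num.Theory.

Local Open Scope classical_set_scope.
Local Open Scope ring_scope.

(** * Convex geometry *)

(** A linear inequality that is tight at a convex combination is tight at every point of positive
    weight, and the face it cuts out is the single point [x]. *)
Lemma vertex_conv_hull (R : realType) (n : nat) (S : set 'rV[R]_n) :
  vertex (conv_hull S) `<=` S.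
Proof.
move=> x [l [b [Hl Fx]]].
have [[m [v [c [Sv c_ge0 c_sum xE]]]] xl] :
    conv_hull S x /\ (x *m l) 0 0 = b.
  by have : [set x] x by []; rewrite Fx.
have Cv j : conv_hull S (v j).
  exists 1%N, (fun=> v j), (fun=> 1).
  by split=> //; rewrite ?big_ord1 ?scale1r.
have [j cj_neq0] : exists j, c j != 0.
  apply/existsP; apply: contraT; rewrite negb_exists => /forallP c0.
  move: c_sum; rewrite big1 => [/esym/eqP|j _]; first by rewrite oner_eq0.
  by apply/eqP; have := c0 j; rewrite negbK.
have gap_ge0 i : 0 <= c i * ((v i *m l) 0 0 - b).
  by rewrite mulr_ge0 // subr_ge0 Hl.
have : \sum_i c i * ((v i *m l) 0 0 - b) = 0.
  under eq_bigr do rewrite mulrBr.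
  rewrite sumrB -mulr_suml c_sum mul1r -xl xE mulmx_suml summxE.
  under [X in _ - X]eq_bigr do rewrite -scalemxAl mxE.
  by rewrite subrr.
move/eqP; rewrite psumr_eq0 // => /allP /(_ j).
rewrite mem_index_enum => /(_ isT) /=.
rewrite mulf_eq0 (negPf cj_neq0) subr_eq0 /= => /eqP vjl.
have -> : x = v j by have : [set x] (v j) by rewrite Fx.
exact: Sv.
Qed.

Lemma affinely_independent_comp (R : realType) (n p q : nat)
    (v : 'I_q -> 'rV[R]_n) (f : 'I_p -> 'I_q) :
  injective f -> affinely_independent v -> affinely_independent (v \o f).
Proof.
move=> f_inj v_ai c c0 cv0 i.
pose c' j := \sum_(i | f i == j) c i.
have c'f : c' (f i) = c i.
  rewrite /c' (bigD1 i) //= big1 ?addr0 // => i' /andP[/eqP/f_inj ->].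
  by rewrite eqxx.
rewrite -c'f; apply: v_ai.
  by rewrite -[RHS]c0 [RHS](partition_big f xpredT) //=.
rewrite -[RHS]cv0 [RHS](partition_big f xpredT) //=.
apply: eq_bigr => j _; rewrite scaler_suml.
by apply: eq_bigr => i' /eqP <-.
Qed.

(** With the ray generators of a simplicial cone as rows of [V], these points witness that the cone
    is full-dimensional. *)
Lemma affinely_independent_cone_points (R : realType) (n : nat)
    (V : 'M[R]_n) : V \in unitmx ->
  affinely_independent (fun i : 'I_n.+1 =>
    if unlift ord0 i is Some j then row j V else 0).
Proof.
move=> Vu c; rewrite !big_ord_recl unlift_none scaler0 add0r => c0 cV0.
have c_lift j : c (lift ord0 j) = 0.
  pose u : 'rV_n := \row_j c (lift ord0 j).
  suff u0 : u = 0 by have := congr1 (fun x : 'rV_n => x 0 j) u0; rewrite !mxE.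
  apply: (can_inj (mulmxK Vu)); rewrite mul0mx mulmx_sum_row -[RHS]cV0.
  by apply: eq_bigr => k _; rewrite mxE liftK.
move=> i; case: (unliftP ord0 i) => [j ->|->]; first exact: c_lift.
by move: c0; rewrite big1 ?addr0.
Qed.

(* Overwriting the column [i] of the coordinate matrix by ones turns affine
   into linear independence, while the column [j] stays zero. *)
Lemma affinely_independent_codim2 (R : realType) (n p : nat) (S : 'M[R]_n)
    (v : 'I_p -> 'rV[R]_n) (i j : 'I_n) :
    S \in unitmx -> i != j -> affinely_independent v ->
    (forall k, (v k *m S) 0 i = 0) -> (forall k, (v k *m S) 0 j = 0) ->
  (p < n)%N.
Proof.
move=> Su ij v_ai vi vj.
pose B := \matrix_(k < p, t < n) (if t == i then 1 else (v k *m S) 0 t).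
have B_free : row_free B.
  apply: inj_row_free => u uB.
  have uBt t : \sum_k u 0 k * B k t = 0.
    by have := congr1 (fun x : 'rV_n => x 0 t) uB; rewrite !mxE.
  have u0 : \sum_k u 0 k = 0.
    rewrite -[RHS](uBt i); apply: eq_bigr => k _.
    by rewrite mxE eqxx mulr1.
  have uv0 : \sum_k u 0 k *: v k = 0.
    apply: (can_inj (mulmxK Su)); apply/rowP => t.
    rewrite mul0mx mulmx_suml summxE mxE.
    under eq_bigr do rewrite -scalemxAl mxE.
    have [->|ti] := eqVneq t i.
      by apply: big1 => k _; rewrite vi mulr0.
    rewrite -[RHS](uBt t); apply: eq_bigr => k _.
    by rewrite [B k t]mxE (negPf ti).
  by apply/rowP => k; rewrite mxE; exact: v_ai.
have Bj : B *m delta_mx j (0 : 'I_1) = 0.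
  apply/matrixP => k t; rewrite mxE [RHS]mxE big1 // => s _.
  rewrite [B k s]mxE [delta_mx _ _ _ _]mxE.
  have [->|_] := eqVneq s j; last by rewrite mulr0.
  by rewrite eq_sym (negPf ij) vj mul0r.
have := mulmx0_rank_max Bj; rewrite mxrank_delta.
by move: B_free; rewrite /row_free => /eqP ->; rewrite addn1.
Qed.

(** A valid form [l] is a nonnegative combination, with weights [mu], of the coordinates of
    [x *m S], so its face is where the coordinates of nonzero weight vanish. Counting dimensions
    leaves exactly one such weight. *)
Lemma facet_simplicial_cone (R : realType) (n : nat) (S : 'M[R]_n)
    (F : set 'rV[R]_n) (C := [set x | forall i, 0 <= (x *m S) 0 i]) :
    S \in unitmx -> facet C F ->
  exists i, F = [set x | C x /\ (x *m S) 0 i = 0].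
Proof.
move=> Su [[l [b [Hl FE]]] [d [[[v [v_ai Fv]] F_max] [[w [w_ai Cw]] C_max]]]].
have C0 : C 0 by move=> i; rewrite mul0mx mxE.
(* The cone contains 0 and the double of a point of [F], whence [b <= 0] and [b <= b + b]. *)
have b0 : b = 0.
  have b_le0 : b <= 0 by have := Hl _ C0; rewrite mul0mx mxE.
  have := Fv ord0; rewrite FE => -[Cv vb].
  have : C (v ord0 + v ord0) by move=> i; rewrite mulmxDl mxE addr_ge0.
  move/Hl; rewrite mulmxDl mxE vb => b_ge0.
  by apply/eqP; rewrite eq_le b_le0; move: b_ge0; rewrite -subr_ge0 addrK.
pose V := invmx S.
have Vu : V \in unitmx by rewrite unitmx_inv.
have CV i : C (row i V).
  move=> j; rewrite -row_mul mulVmx // !mxE.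
  by case: (_ == _); rewrite ?ler01.
pose mu i := (row i V *m l) 0 0.
have mu_ge0 i : 0 <= mu i by rewrite -b0 Hl.
have lE (x : 'rV_n) : (x *m l) 0 0 = \sum_i (x *m S) 0 i * mu i.
  have {1}-> : x = \sum_i (x *m S) 0 i *: row i V.
    by rewrite -mulmx_sum_row mulmxK.
  rewrite mulmx_suml summxE.
  by apply: eq_bigr => i _; rewrite -scalemxAl mxE.
have F_mu (x : 'rV_n) i : F x -> mu i != 0 -> (x *m S) 0 i = 0.
  rewrite FE => -[Cx]; rewrite b0 lE => /eqP.
  rewrite psumr_eq0 => [/allP /(_ i)|j _]; last by rewrite mulr_ge0.
  rewrite mem_index_enum => /(_ isT) /=.
  by rewrite mulf_eq0 => /orP[/eqP //|->].
(* If all weights vanished, [F] would be all of [C], against its dimension. *)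
have [i mui] : exists i, mu i != 0.
  apply/existsP; apply: contraT; rewrite negb_exists => /forallP mu0.
  case: F_max; exists w; split=> // k; rewrite FE; split=> //.
  rewrite b0 lE big1 // => i _; apply/eqP; rewrite mulf_eq0 orbC.
  by have := mu0 i; rewrite negbK => ->.
have n_le : (n <= d.+1)%N.
  rewrite leqNgt; apply/negP => dn; apply: C_max.
  have dn' : (d.+3 <= n.+1)%N by [].
  have f_inj : injective (widen_ord dn').
    by move=> k1 k2 /(congr1 val) /= /val_inj.
  have := affinely_independent_comp f_inj (affinely_independent_cone_points Vu).
  move=> ai; eexists; split; first exact: ai.
  by move=> k /=; case: unliftP => [j _|_].
(* A second nonzero weight would put the [d + 1] independent points of [F] in codimension two,
   forcing [d + 1 < n]. *)
have mu0 j : j != i -> mu j = 0.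
  move=> ji; apply/eqP; apply: contraT => muj.
  have := affinely_independent_codim2 Su ji v_ai.
  move/(_ (fun k => F_mu _ _ (Fv k) muj) (fun k => F_mu _ _ (Fv k) mui)).
  by rewrite ltnNge n_le.
exists i; apply/seteqP; split=> x.
  by move=> Fx; split; [move: Fx; rewrite FE => -[] | exact: F_mu].
case=> Cx xi; rewrite FE; split=> //.
rewrite b0 lE big1 // => j _.
by have [->|/mu0->] := eqVneq j i; rewrite ?xi ?mul0r ?mulr0.
Qed.

(** * Lattice heights over a simplicial cone *)

Lemma real_point_mulmx (R : realType) (n p : nat) (q : 'rV[int]_n)
    (S : 'M[int]_(n, p)) i :
  (real_point R q *m map_mx intr S) 0 i = ((q *m S) 0 i)%:~R.
Proof. by rewrite /real_point -map_mxM mxE. Qed.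

Lemma normalization_simplicial (R : realType) (n : nat) (P : set 'rV[R]_n)
    (S : 'M[int]_(n + 1)) :
    cone_of P = [set x | forall i, 0 <= (x *m map_mx intr S) 0 i] ->
    group_of P = setT ->
  normalization P = [set q | forall i, 0 <= (q *m S) 0 i].
Proof.
move=> coneE groupE; rewrite /normalization coneE groupE.
apply/seteqP; split=> q /= => [[_]|] Hq; [|split=> //]; move=> i.
  by have := Hq i; rewrite real_point_mulmx ler0z.
by rewrite real_point_mulmx ler0z.
Qed.

(** The facet is the zero set of one coordinate on the cone, and that coordinate is a lattice height
    because it takes the value 1. Any lattice height vanishes on the kernel of this coordinate, so
    it is a multiple of it, and surjectivity forces the factor to be 1. *)
Lemma lattice_height_simplicial (R : realType) (n : nat) (P : set 'rV[R]_n)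
    (S : 'M[int]_(n + 1)) (F : set 'rV[R]_(n + 1)) :
    map_mx intr S \in (unitmx : {pred 'M[R]_(n + 1)}) ->
    cone_of P = [set x | forall i, 0 <= (x *m map_mx intr S) 0 i] ->
    group_of P = setT ->
    (forall i, exists2 w, normalization P w & (w *m S) 0 i = 1) ->
    semigroup_facet P F ->
  exists i, forall q, lattice_height P F q = (q *m S) 0 i.
Proof.
move=> Su coneE groupE unit_height; rewrite /semigroup_facet coneE => facetF.
have normE := normalization_simplicial coneE groupE.
have [i FE] := facet_simplicial_cone Su facetF.
exists i; have [w Nw wi] := unit_height i.
have detS : \det S != 0.
  by move: Su; rewrite unitmxE det_map_mx unitfE intr_eq0.
(* A lattice point in the relative interior of [F]: the adjugate makes its coordinate 0 at [i] and
   the positive square of [\det S] elsewhere. *)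
pose f : 'rV[int]_(n + 1) :=
  (\row_j (if j == i then 0 else \det S)) *m \adj S.
have fE j : (f *m S) 0 j = if j == i then 0 else \det S * \det S.
  rewrite /f -mulmxA mul_adj_mx mul_mx_scalar !mxE.
  by case: eqP; rewrite ?mulr0.
have wn c : 0 <= c -> normalization P (w *~ c).
  rewrite normE => c0 j; rewrite -scaler_int -scalemxAl mxE intz.
  by rewrite mulr_ge0 //; move: Nw; rewrite normE; exact.
have height : is_lattice_height P F (fun q => (q *m S) 0 i).
  split=> [x y _ _|x _|]; first by rewrite mulmxDl mxE.
    by rewrite FE /= real_point_mulmx => -[_ /eqP]; rewrite intr_eq0 => /eqP.
  apply/seteqP; split=> [_ [q + <-]|c c0]; first by rewrite normE; exact.
  exists (w *~ c); first exact: wn.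
  by rewrite -scaler_int -scalemxAl mxE wi mulr1 intz.
(* Since a height exists, [xget] returns one and not its default value; the rest is uniqueness. *)
have := xgetPex (fun=> 0) (ex_intro _ _ height).
rewrite -/(lattice_height P F); set s := lattice_height P F.
case; rewrite groupE => sD sF sN q.
have {}sD x y : s (x + y) = s x + s y by exact: sD.
have s0 : s 0 = 0 by apply: (addrI (s 0)); rewrite -sD !addr0.
have sn x c : s (x *+ c) = s x *+ c.
  by elim: c => // c IH; rewrite !mulrS sD IH.
have sNn x : s (- x) = - s x.
  by apply/eqP; rewrite -subr_eq0 opprK -sD addNr s0.
have sz x c : s (x *~ c) = s x * c.
  case: c => c; first by rewrite -pmulrn sn -mulr_natr natz.
  by rewrite NegzE mulrNz mulrN sNn -pmulrn sn -mulr_natr natz.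
(* A lattice point of the hyperplane of [F] lies in [F] after adding a large
   multiple of [f], so [s] vanishes on that hyperplane. *)
have s_ker x : (x *m S) 0 i = 0 -> s x = 0.
  move=> xi; pose M := \sum_j `|(x *m S) 0 j|.
  have M0 : 0 <= M by rewrite sumr_ge0.
  have Fplus (y : 'rV_(n + 1)) c : 0 <= c -> (y *m S) 0 i = 0 ->
      (forall j, - c <= (y *m S) 0 j) -> F (real_point R (y + f *~ c)).
    move=> c0 yi yc; rewrite FE.
    have E j : ((y + f *~ c) *m S) 0 j = (y *m S) 0 j + c * (f *m S) 0 j.
      by rewrite -scaler_int mulmxDl -scalemxAl mxE [X in _ + X]mxE intz.
    split=> [j|]; rewrite real_point_mulmx E fE.
      rewrite ler0z; case: eqP => [->|_]; first by rewrite yi mulr0.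
      have d1 : 1 <= \det S * \det S.
        have : \det S * \det S != 0 by rewrite mulf_eq0 negb_or detS.
        have := sqr_ge0 (\det S); rewrite expr2; lia.
      have := yc j; nia.
    by rewrite eqxx yi mulr0.
  have sfM c : 0 <= c -> s (f *~ c) = 0.
    move=> c0; apply: sF => //; rewrite -[f *~ c]add0r; apply: Fplus => //.
      by rewrite mul0mx mxE.
    by move=> j; rewrite mul0mx mxE oppr_le0.
  have : s (x + f *~ M) = 0.
    apply: sF => //; apply: Fplus => // j.
    rewrite lerNl (le_trans (ler_norm _)) // normrN /M (bigD1 j) //=.
    by rewrite lerDl sumr_ge0.
  by rewrite sD (sfM _ M0) addr0.
have sE x : s x = s w * (x *m S) 0 i.
  have : s (x - w *~ (x *m S) 0 i) = 0.
    apply: s_ker; rewrite mulmxBl -scaler_int -scalemxAl mxE [X in _ + X]mxE.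
    by rewrite [X in _ - X]mxE wi mulr1 intz subrr.
  by rewrite sD sNn sz => /eqP; rewrite subr_eq0 => /eqP.
have sw_ge0 : 0 <= s w.
  by have : (s @` normalization P) (s w) by [exists w]; rewrite sN.
have [y Ny] : (s @` normalization P) 1 by rewrite sN.
have : 0 <= (y *m S) 0 i by move: Ny; rewrite normE; exact.
move=> y0; rewrite sE => sy; rewrite sE.
(* The value [s y = 1] is a product of the nonnegative integers [s w] and the coordinate of [y]. *)
suff -> : s w = 1 by rewrite mul1r.
move: sw_ge0 y0 sy; move: (s w) ((y *m S) 0 i) => a b a0 b0 ab.
have [b_eq0|b_ge1] : b = 0 \/ 1 <= b by lia.
  by move: ab; rewrite b_eq0 mulr0.
nia.
Qed.

(** Greedy splitting: one summand absorbs as many steps [d] and [d'] as it can, and the remainder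
    stays within the bounds for [n] summands. *)
Lemma submonoid_arithmetic_sums (V : zmodType) (S : set V) (g d d' : V)
    (c c' : nat) : submonoid S ->
    (forall i j, (i <= c)%N -> (j <= c')%N -> S (g + d *+ i + d' *+ j)) ->
  forall n i j, (i <= c * n)%N -> (j <= c' * n)%N ->
    S (g *+ n + d *+ i + d' *+ j).
Proof.
move=> [S0 SD] Sg; elim=> [|n IH] i j.
  by rewrite !muln0 !leqn0 => /eqP-> /eqP->; rewrite !mulr0n !addr0.
rewrite !mulnS => ic jc.
have -> : g *+ n.+1 + d *+ i + d' *+ j =
    (g + d *+ minn c i + d' *+ minn c' j) +
    (g *+ n + d *+ (i - minn c i) + d' *+ (j - minn c' j)).
  rewrite mulrS -{1}(subnKC (geq_minr c i)) -{1}(subnKC (geq_minr c' j)).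
  by rewrite !mulrnDr (addrACA g) [LHS]addrACA.
apply: SD; first by apply: Sg; rewrite geq_minl.
by apply: IH; lia.
Qed.

(** * The simplex *)

(* [r] is the common residue of [a] and [a + 4 m b] modulo [4 m]; the
   obstructed case is [a + 2 e] odd, [2 m < r] and [a = r]. *)
Lemma cone_decomposition (m a b e h : int) : 0 < m ->
    0 <= a -> 0 <= a + 4 * m * b ->
    0 <= (2 * m - 1) * a - 4 * m * b + 4 * m * e ->
    0 <= 12 * m * h - (6 * m + 1) * a - 12 * m * e ->
  (exists nA tA nB tB nM p x : int,
    [/\ [/\ 0 <= nA, 0 <= nB & 0 <= nM],
        [/\ 0 <= tA <= 3 * nA, 0 <= tB <= nB, 0 <= p <= (m - 1) * nM
          & 0 <= x <= nM]
      & [/\ a = 4 * m * tA + nM + 2 * p + 4 * m * x,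
            b = - tA + tB - x,
            e = - 2 * m * tA + nB - p - 2 * m * x
          & h = nA + nB + nM]])
  \/ [/\ 2 * m < a, 2 * m < a + 4 * m * b,
         2 * m < (2 * m - 1) * a - 4 * m * b + 4 * m * e
       & 2 * m < 12 * m * h - (6 * m + 1) * a - 12 * m * e].
Proof.
move=> m0 a0 u0 v0 w0.
have m4 : 0 < 4 * m by lia.
pose t' := (a %/ (4 * m))%Z; pose r := (a %% (4 * m))%Z.
have aE : a = t' * (4 * m) + r by exact: divz_eq.
have r0 : 0 <= r by rewrite modz_ge0 // gt_eqF.
have r4 : r < 4 * m by rewrite ltz_pmod.
move: t' r aE r0 r4 => t' r aE r0 r4.
have t'0 : 0 <= t' by nia.
(* [t'] and [t] are the quotients of [a] and [a + 4 m b] by [4 m], with common remainder [r]. *)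
pose t := t' + b.
have bE : b = t - t' by rewrite /t; lia.
move: t bE => t bE.
have t0 : 0 <= t by nia.
(* From here on [s] is the floor of [(a + 2 e) / 2], and [rho] is the parity of [a], hence of
   [r]. *)
pose s := ((a + 2 * e) %/ 2)%Z; pose rho := ((a + 2 * e) %% 2)%Z.
have sE : a + 2 * e = s * 2 + rho by exact: divz_eq.
have rho01 : rho = 0 \/ rho = 1 by rewrite /rho; lia.
move: s rho sE rho01 => s rho sE rho01.
pose j := ((r - rho) %/ 2)%Z.
have rE : r = 2 * j + rho by rewrite /j; lia.
move: j rE => j rE.
have eE : e = s - j - 2 * m * t' by nia.
subst b e; subst a.
case: rho01 => rhoE; subst rho; subst r.
- have ts : 4 * m * t + 2 * j <= 4 * m * s by nia.
  have ths : 4 * m * t' + 2 * j <= 12 * m * (h - s) by nia.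
  (* Residue 0 uses edge points alone. The witnesses [nA], [nB], [nM] count generators on the long
     edge, on the short edge and in the middle slice; [tA], [tB] are the total steps along the
     edges. *)
  have [j0|j1] : j = 0 \/ 1 <= j by lia.
    subst j; left; exists (h - s), t', s, t, 0, 0, 0.
    split; split; nia.
  have ts1 : t <= s - 1 by nia.
  have ths1 : t' <= 3 * (h - s) - 1 by nia.
  (* Two middle points realise the residue [2 j] as [2 + 2 p]. The part of [t'] beyond the capacity
     of the [h - s - 1] long-edge points is left to them as [x]. *)
  pose x := Num.max 0 (t' - 3 * (h - s - 1)).
  have xE : [/\ 0 <= x, x <= 2, x <= t' & t' - x <= 3 * (h - s - 1)].
    by rewrite /x; split; lia.
  move: x xE => x [x0 x2 xt xh].
  left; exists (h - s - 1), (t' - x), (s - 1), t, 2, (j - 1), x.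
  split; split; nia.
- have ts : 4 * m * t + 2 * j + 1 <= 4 * m * s + 2 * m by nia.
  have ths : 4 * m * t' + 2 * j + 1 <= 12 * m * (h - s - 1) + 6 * m by nia.
  (* For [j < m] the residue [2 j + 1] is that of a single middle point. *)
  have [jm|jm] := ltP j m.
    have ts1 : t <= s by nia.
    have ths1 : t' <= 3 * (h - s - 1) + 1 by nia.
    pose x := Num.max 0 (t' - 3 * (h - s - 1)).
    have xE : [/\ 0 <= x, x <= 1, x <= t' & t' - x <= 3 * (h - s - 1)].
      by rewrite /x; split; nia.
    move: x xE => x [x0 x2 xt xh].
    left; exists (h - s - 1), (t' - x), s, t, 1, j, x.
    split; split; nia.
  have ts1 : t <= s - 1 by nia.
  have ths1 : t' <= 3 * (h - s - 1) by nia.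
  (* Three middle points replace one middle point and one point of each edge. If [h - s - 1 = 0],
     there is no long-edge point to trade, which is the deep case. *)
  have [h0|h1] : h - s - 1 = 0 \/ 1 <= h - s - 1 by lia.
    have hE : h = s + 1 by lia.
    have t'E : t' = 0 by lia.
    subst h t'; right; split; nia.
  pose x := Num.max 0 (t' - 3 * (h - s - 2)).
  have xE : [/\ 0 <= x, x <= 3, x <= t' & t' - x <= 3 * (h - s - 2)].
    by rewrite /x; split; lia.
  move: x xE => x [x0 x2 xt xh].
  left; exists (h - s - 2), (t' - x), (s - 1), t, 3, (j - 1), x.
  split; split; nia.
Qed.

(** The slice coordinates [a + 2 e] of the two summands lie between 0 and 2 and add up to 3, so one
    summand is a middle point and the other is on the short edge. The latter has residue 0 modulo
    [4 m], which leaves the middle point with the residue [2 m + 1], too large for it. *)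
Lemma hole_not_sum (m a b e a' b' e' : int) : 0 < m ->
    0 <= a -> 0 <= a + 4 * m * b ->
    0 <= (2 * m - 1) * a - 4 * m * b + 4 * m * e ->
    0 <= 12 * m - (6 * m + 1) * a - 12 * m * e ->
    0 <= a' -> 0 <= a' + 4 * m * b' ->
    0 <= (2 * m - 1) * a' - 4 * m * b' + 4 * m * e' ->
    0 <= 12 * m - (6 * m + 1) * a' - 12 * m * e' ->
    a + a' = 2 * m + 1 -> b + b' = 0 -> e + e' = 1 - m ->
  False.
Proof.
move=> m0; wlog : a b e a' b' e' / a + 2 * e <= a' + 2 * e' => [wl|].
  move=> H1 H2 H3 H4 H5 H6 H7 H8 H9 H10 H11.
  have [le|lt] := leP (a + 2 * e) (a' + 2 * e').
    exact: (wl a b e a' b' e').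
  by apply: (wl a' b' e' a b e) => //; lia.
move=> se H1 H2 H3 H4 H5 H6 H7 H8 H9 H10 H11.
have s' : a' + 2 * e' = 2 by nia.
have s1 : a + 2 * e = 1 by lia.
have a'0 : a' = 0 by nia.
have e'1 : e' = 1 by lia.
subst a' e'.
have [bb|bb] : b' = 0 \/ b' = 1 by nia.
all: nia.
Qed.

(** * Coordinates, facet heights and vertices *)

Definition vec4 (K : nmodType) (a b e h : K) : 'rV[K]_(3 + 1) :=
  \row_i [:: a; b; e; h]`_i.

(** With [u = a + 4 m b] and [s = a + 2 e], the columns are the forms [a], [u], [2 m s - u] and
    [6 m (2 h - s) - a]. *)
Definition facet_heights (m : int) : 'M[int]_(3 + 1) :=
  \matrix_(i, j) (nth [::]
    [:: [:: 1; 1; 2 * m - 1; - (6 * m + 1)]; [:: 0; 4 * m; - (4 * m); 0];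
        [:: 0; 0; 4 * m; - (12 * m)]; [:: 0; 0; 0; 12 * m]] i)`_j.

(* The vertex [i] is opposite to the facet whose height is the column [i] of
   [facet_heights m]. *)
Definition deep_vertex (m : int) (i : 'I_4) : 'rV[int]_3 :=
  \row_j (nth [::]
    [:: [:: 12 * m; -3; - (6 * m)]; [:: 0; 1; 1]; [:: 0; 0; 1]; [::]] i)`_j.

Definition deep_simplex (R : realType) (m : int) : set 'rV[R]_3 :=
  conv_hull (range (fun i => real_point R (deep_vertex m i))).
Arguments deep_simplex : clear implicits.

Lemma vec4_eta (K : nmodType) (x : 'rV[K]_(3 + 1)) :
  exists a b e h, x = vec4 a b e h.
Proof.
exists (x 0 (inord 0)), (x 0 (inord 1)), (x 0 (inord 2)), (x 0 (inord 3)).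
apply/rowP; case=> [[|[|[|[|//]]]] lt4]; rewrite mxE /=;
  by congr (x _ _); apply: val_inj; rewrite /= inordK.
Qed.

Lemma vec4_inj (K : nmodType) (a b e h a' b' e' h' : K) :
  vec4 a b e h = vec4 a' b' e' h' -> [/\ a = a', b = b', e = e' & h = h'].
Proof.
move=> /rowP E; split.
- by have := E (@Ordinal 4 0 isT); rewrite !mxE.
- by have := E (@Ordinal 4 1 isT); rewrite !mxE.
- by have := E (@Ordinal 4 2 isT); rewrite !mxE.
- by have := E (@Ordinal 4 3 isT); rewrite !mxE.
Qed.

Lemma vec4D (K : nmodType) (a b e h a' b' e' h' : K) :
  vec4 a b e h + vec4 a' b' e' h' = vec4 (a + a') (b + b') (e + e') (h + h').
Proof. by apply/rowP; case=> [[|[|[|[|//]]]] lt4]; rewrite !mxE. Qed.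

Lemma vec4Mn (K : nmodType) (a b e h : K) n :
  vec4 a b e h *+ n = vec4 (a *+ n) (b *+ n) (e *+ n) (h *+ n).
Proof. by apply/rowP; case=> [[|[|[|[|//]]]] lt4]; rewrite mulmxnE !mxE. Qed.

Lemma row_mx1_vec4 (K : nzRingType) (p : 'rV[K]_3) :
  exists a b e, row_mx p 1 = vec4 a b e 1.
Proof.
have [a [b [e [h pE]]]] := vec4_eta (row_mx p 1).
exists a, b, e; rewrite pE; congr vec4.
have : row_mx p 1 0 (rshift 3 0) = h by rewrite pE mxE.
by rewrite row_mxEr mxE eqxx.
Qed.

Lemma real_point_row_mx1 (R : realType) n (p : 'rV[int]_n) :
  real_point R (row_mx p (1 : 'rV_1)) = row_mx (real_point R p) 1.
Proof. by rewrite /real_point map_row_mx map_mx1. Qed.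

Lemma vec4_heights (K : comNzRingType) (f : {rmorphism int -> K})
    (m : int) (a b e h : K) j :
  (vec4 a b e h *m map_mx f (facet_heights m)) 0 j =
  [:: a; a + 4 * f m * b;
      (2 * f m - 1) * a - 4 * f m * b + 4 * f m * e;
      12 * f m * h - (6 * f m + 1) * a - 12 * f m * e]`_j.
Proof.
case: j => [[|[|[|[|//]]]] lt4].
all: rewrite mxE !big_ord_recl big_ord0 !mxE /=.
all: by rewrite ?rmorphN ?rmorphB ?rmorphD ?rmorphM ?rmorph1 ?rmorph0
  ?rmorph_nat; ring.
Qed.

Lemma vec4_heights_ge0P (K : numDomainType) (f : {rmorphism int -> K})
    (m : int) (a b e h : K) :
  (forall i, 0 <= (vec4 a b e h *m map_mx f (facet_heights m)) 0 i) <->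
  [/\ 0 <= a, 0 <= a + 4 * f m * b,
      0 <= (2 * f m - 1) * a - 4 * f m * b + 4 * f m * e
    & 0 <= 12 * f m * h - (6 * f m + 1) * a - 12 * f m * e].
Proof.
split=> [H|[H0 H1 H2 H3] i]; last first.
  by rewrite vec4_heights; case: i => [[|[|[|[|//]]]] lt4].
split.
- by have := H (@Ordinal 4 0 isT); rewrite vec4_heights.
- by have := H (@Ordinal 4 1 isT); rewrite vec4_heights.
- by have := H (@Ordinal 4 2 isT); rewrite vec4_heights.
- by have := H (@Ordinal 4 3 isT); rewrite vec4_heights.
Qed.

Lemma int_vec4_heights (m a b e h : int) j :
  (vec4 a b e h *m facet_heights m) 0 j =
  [:: a; a + 4 * m * b;
      (2 * m - 1) * a - 4 * m * b + 4 * m * e;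
      12 * m * h - (6 * m + 1) * a - 12 * m * e]`_j.
Proof.
by rewrite -(map_mx_id_in (f := idfun) (M := facet_heights m)) // vec4_heights.
Qed.

Lemma int_vec4_heights_ge0P (m a b e h : int) :
  (forall i, 0 <= (vec4 a b e h *m facet_heights m) 0 i) <->
  [/\ 0 <= a, 0 <= a + 4 * m * b,
      0 <= (2 * m - 1) * a - 4 * m * b + 4 * m * e
    & 0 <= 12 * m * h - (6 * m + 1) * a - 12 * m * e].
Proof.
have := vec4_heights_ge0P idfun m a b e h.
by rewrite map_mx_id_in.
Qed.

Lemma sum_scale_row_mx1 (K : nzRingType) (n p : nat) (c : 'I_p -> K)
    (v : 'I_p -> 'rV[K]_n) :
  \sum_i c i *: row_mx (v i) (1 : 'rV_1) =
  row_mx (\sum_i c i *: v i) (\sum_i c i)%:M.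
Proof.
rewrite -[LHS]hsubmxK !linear_sum /=; congr row_mx.
  by apply: eq_bigr => i _; rewrite linearZ /= row_mxKl.
rewrite [RHS]raddf_sum /=.
by apply: eq_bigr => i _; rewrite linearZ /= row_mxKr scale_scalar_mx mulr1.
Qed.

(** The diagonal of the matrix of vertex heights; the other entries vanish because a vertex lies on
    every facet but the opposite one. *)
Definition vertex_height (m : int) (i : 'I_(3 + 1)) : int :=
  [:: 12 * m; 4 * m; 4 * m; 12 * m]`_i.

Lemma vertex_height_gt0 (m : int) i : 0 < m -> 0 < vertex_height m i.
Proof. by case: i => [[|[|[|[|//]]]] lt4]; rewrite /vertex_height /=; lia. Qed.

Lemma deep_vertex_heights (m : int) (i j : 'I_(3 + 1)) :
  (row_mx (deep_vertex m i) 1 *m facet_heights m) 0 j =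
  if i == j then vertex_height m i else 0.
Proof.
have -> : row_mx (deep_vertex m i) 1 =
    nth 0 [:: vec4 (12 * m) (-3) (- (6 * m)) 1; vec4 0 1 1 1; vec4 0 0 1 1;
              vec4 0 0 0 1] i.
  apply/rowP => k; rewrite mxE; case: splitP => [] [k' lt3] /= kE.
    have -> : k = lshift 1 (Ordinal lt3) by apply: val_inj.
    rewrite mxE; case: i => [[|[|[|[|//]]]] lt4]; rewrite mxE /=;
      by case: k' lt3 {kE} => [|[|[|]]].
  have -> : k = rshift 3 (Ordinal lt3) by apply: val_inj.
  case: k' lt3 {kE} => // lt1; rewrite !mxE /=.
  by case: i => [[|[|[|[|//]]]] lt4]; rewrite mxE.
case: i => [[|[|[|[|//]]]] lt4]; case: j => [[|[|[|[|//]]]] lt4'].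
all: by rewrite int_vec4_heights /vertex_height /= /eq_op /=; ring.
Qed.

Lemma facet_heights_unit (R : realType) (m : int) : 0 < m ->
  map_mx intr (facet_heights m) \in (unitmx : {pred 'M[R]_(3 + 1)}).
Proof.
move=> m0; rewrite -row_free_unit; apply: inj_row_free => y.
have [a [b [e [h ->]]]] := vec4_eta y => /rowP yS.
have m4 : 4 * m%:~R != 0 :> R.
  by rewrite mulf_neq0 ?pnatr_eq0 // intr_eq0 gt_eqF.
have := yS (@Ordinal 4 0 isT); rewrite vec4_heights mxE /= => a0; subst a.
have := yS (@Ordinal 4 1 isT); rewrite vec4_heights mxE /= => b0.
have {}b0 : b = 0 by apply: (mulfI m4); lra.
have := yS (@Ordinal 4 2 isT); rewrite vec4_heights mxE /= b0 => e0.
have {}e0 : e = 0 by apply: (mulfI m4); lra.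
have := yS (@Ordinal 4 3 isT); rewrite vec4_heights mxE /= e0 => h0.
have -> : h = 0 by apply: (mulfI m4); lra.
by apply/rowP; case=> [[|[|[|[|//]]]] lt4]; rewrite !mxE.
Qed.

Lemma deep_vertex_combination (R : realType) (m : int) (c : 'I_(3 + 1) -> R) j :
  ((\sum_i c i *: row_mx (real_point R (deep_vertex m i)) 1)
     *m map_mx intr (facet_heights m)) 0 j = c j * (vertex_height m j)%:~R.
Proof.
have E i : (c i *: row_mx (real_point R (deep_vertex m i)) 1
    *m map_mx intr (facet_heights m)) 0 j =
    c i * (if i == j then vertex_height m i else 0)%:~R.
  rewrite -scalemxAl mxE -real_point_row_mx1 real_point_mulmx.
  by rewrite deep_vertex_heights.
rewrite mulmx_suml summxE (bigD1 j) //= big1 => [|i ij].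
  by rewrite E eqxx addr0.
by rewrite E (negPf ij) mulr0.
Qed.

(** The heights determine a point, and those of the vertices form a diagonal matrix, so division
    gives the coefficients. In degree one they are barycentric coordinates. *)
Lemma deep_cone_coordinates (R : realType) (m : int) (y : 'rV[R]_(3 + 1)) :
    0 < m ->
  y = \sum_i ((y *m map_mx intr (facet_heights m)) 0 i /
              (vertex_height m i)%:~R) *:
        row_mx (real_point R (deep_vertex m i)) 1.
Proof.
move=> m0; have Su := facet_heights_unit R m0.
apply: (can_inj (mulmxK Su)); apply/rowP => j.
rewrite deep_vertex_combination divfK //.
by rewrite intr_eq0 gt_eqF // vertex_height_gt0.
Qed.

Lemma deep_simplexP (R : realType) (m : int) (x : 'rV[R]_3) : 0 < m ->
  deep_simplex R m x <->
  forall i, 0 <= (row_mx x 1 *m map_mx intr (facet_heights m)) 0 i.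
Proof.
move=> m0; split=> [[p [v [c [Vv c0 c1 ->]]]] j|x0].
  have -> : row_mx (\sum_i c i *: v i) 1 =
      \sum_i c i *: row_mx (v i) (1 : 'rV_1).
    by rewrite sum_scale_row_mx1 c1.
  rewrite mulmx_suml summxE sumr_ge0 // => i _.
  have [k _ <-] := Vv i.
  rewrite -scalemxAl mxE mulr_ge0 // -real_point_row_mx1 real_point_mulmx.
  rewrite deep_vertex_heights ler0z; case: eqP => // _.
  by rewrite ltW // vertex_height_gt0.
pose c i : R := (row_mx x 1 *m map_mx intr (facet_heights m)) 0 i /
                (vertex_height m i)%:~R.
have : row_mx x 1 =
    \sum_i c i *: row_mx (real_point R (deep_vertex m i)) (1 : 'rV_1).
  exact: deep_cone_coordinates.
rewrite sum_scale_row_mx1 => /eq_row_mx [xE cE].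
exists 4%N, (fun i => real_point R (deep_vertex m i)), c; split=> //.
- by move=> i; rewrite divr_ge0 // ler0z ltW // vertex_height_gt0.
- by have := congr1 (fun z : 'rV_1 => z 0 0) cE; rewrite !mxE /= mulr1n.
Qed.

Lemma deep_simplex_is_simplex (R : realType) (m : int) : 0 < m ->
  simplex 3 (deep_simplex R m).
Proof.
move=> m0; exists (fun i => real_point R (deep_vertex m i)); split=> //.
move=> c c0 cv0 j.
have : \sum_i c i *: row_mx (real_point R (deep_vertex m i)) (1 : 'rV_1) = 0.
  rewrite sum_scale_row_mx1 c0 cv0; apply/rowP => k.
  by rewrite !mxE; case: splitP => ? _; rewrite !mxE ?mul0rn.
move/(congr1 (fun y => (y *m map_mx intr (facet_heights m)) 0 j)).
rewrite mul0mx deep_vertex_combination mxE => /eqP.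
rewrite mulf_eq0 intr_eq0.
by rewrite [X in _ || X]gt_eqF ?orbF ?vertex_height_gt0 // => /eqP.
Qed.

Lemma deep_simplex_lattice_polytope (R : realType) (m : int) :
  lattice_polytope (deep_simplex R m).
Proof.
split; first by eexists; eexists.
by move=> x /vertex_conv_hull [i _ <-]; exists (deep_vertex m i).
Qed.

(** * The semigroup of the simplex *)

Lemma smallest_submonoid (V : zmodType) (G : set V) :
  submonoid (smallest (@submonoid V) G).
Proof.
split=> [S [[]] //|x y Sx Sy S SG].
by have [[_ SD] _] := SG; apply: SD; [exact: Sx | exact: Sy].
Qed.

Lemma smallest_subgroup (V : zmodType) (G : set V) :
  subgroup (smallest (@subgroup V) G).
Proof.
split=> [S [[]] //|x y Sx Sy S SG].
by have [[_ SB] _] := SG; apply: SB; [exact: Sx | exact: Sy].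
Qed.

Lemma subgroupD (V : zmodType) (S : set V) x y :
  subgroup S -> S x -> S y -> S (x + y).
Proof.
move=> [S0 SB] Sx Sy; have SNy : S (- y) by rewrite -sub0r; apply: SB.
by rewrite -[y]opprK; apply: SB.
Qed.

Lemma subgroupMz (V : zmodType) (S : set V) x (c : int) :
  subgroup S -> S x -> S (x *~ c).
Proof.
move=> Sg Sx; have SMn n : S (x *+ n).
  elim: n => [|n IH]; first by rewrite mulr0n; case: Sg.
  by rewrite mulrS; apply: subgroupD.
case: c => n; first by rewrite -pmulrn.
by rewrite NegzE mulrNz -pmulrn -sub0r; case: Sg => S0; apply.
Qed.

Lemma deep_semigroup_ge0 (R : realType) (m : int) q : 0 < m ->
  semigroup_of (deep_simplex R m) q ->
  forall i, 0 <= (q *m facet_heights m) 0 i.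
Proof.
move=> m0; move: q; apply: smallest_sub.
  split=> [i|x y x0 y0 i]; first by rewrite mul0mx mxE.
  by rewrite mulmxDl mxE addr_ge0.
move=> _ [p /(deep_simplexP _ m0) Pp <-] i.
by have := Pp i; rewrite -real_point_row_mx1 real_point_mulmx ler0z.
Qed.

Lemma deep_semigroup_generator (R : realType) (m a b e : int) : 0 < m ->
    0 <= a -> 0 <= a + 4 * m * b ->
    0 <= (2 * m - 1) * a - 4 * m * b + 4 * m * e ->
    0 <= 12 * m - (6 * m + 1) * a - 12 * m * e ->
  semigroup_of (deep_simplex R m) (vec4 a b e 1).
Proof.
move=> m0 H0 H1 H2 H3; pose p : 'rV[int]_3 := \row_i [:: a; b; e]`_i.
have pE : row_mx p 1 = vec4 a b e 1.
  apply/rowP => k; rewrite !mxE; case: splitP => [] [k' lt3] /= ->.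
    by rewrite mxE /=; case: k' lt3 => [|[|[|]]].
  by case: k' lt3 => // ?; rewrite mxE.
apply: sub_gen_smallest; exists p => //=.
apply/(deep_simplexP _ m0) => i.
rewrite -real_point_row_mx1 pE real_point_mulmx ler0z; move: i.
by apply/int_vec4_heights_ge0P; rewrite mulr1.
Qed.

Lemma deep_cone_of (R : realType) (m : int) : 0 < m ->
  cone_of (deep_simplex R m) =
  [set y | forall i, 0 <= (y *m map_mx intr (facet_heights m)) 0 i].
Proof.
move=> m0; apply/seteqP; split=> [_ [p [v [c [Qv c0 ->]]]] j|y y0].
  rewrite mulmx_suml summxE sumr_ge0 // => i _.
  rewrite -scalemxAl mxE mulr_ge0 //; have [q Qq <-] := Qv i.
  by rewrite real_point_mulmx ler0z (deep_semigroup_ge0 m0 Qq).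
rewrite [y](deep_cone_coordinates _ m0).
do 3!eexists; split; last by [].
  move=> i /=; rewrite -real_point_row_mx1; eexists; last by [].
  apply: sub_gen_smallest; exists (deep_vertex m i) => //=.
  apply/(deep_simplexP _ m0) => j.
  rewrite -real_point_row_mx1 real_point_mulmx ler0z deep_vertex_heights.
  by case: eqP => // _; rewrite ltW // vertex_height_gt0.
by move=> i; rewrite divr_ge0 // ler0z ltW // vertex_height_gt0.
Qed.

Lemma deep_group_of (R : realType) (m : int) : 0 < m ->
  group_of (deep_simplex R m) = setT.
Proof.
move=> m0; apply/seteqP; split=> // y _.
have [a [b [e [h ->]]]] := vec4_eta y.
have Gg := smallest_subgroup (semigroup_of (deep_simplex R m)).
have gen a' b' e' : 0 <= a' -> 0 <= a' + 4 * m * b' ->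
    0 <= (2 * m - 1) * a' - 4 * m * b' + 4 * m * e' ->
    0 <= 12 * m - (6 * m + 1) * a' - 12 * m * e' ->
    group_of (deep_simplex R m) (vec4 a' b' e' 1).
  by move=> *; apply: sub_gen_smallest; apply: deep_semigroup_generator.
(* A middle lattice point and three vertices form a basis of the lattice. *)
have -> : vec4 a b e h = vec4 1 0 0 1 *~ a + vec4 0 1 1 1 *~ b +
    vec4 0 0 1 1 *~ (e - b) + vec4 0 0 0 1 *~ (h - a - e).
  rewrite -!scaler_int !intz; apply/rowP.
  by case=> [[|[|[|[|//]]]] lt4]; rewrite !mxE /=; lia.
by do 3?[apply: (subgroupD Gg)]; apply: (subgroupMz _ Gg); apply: gen; lia.
Qed.

Lemma deep_semigroup_or_deep (R : realType) (m a b e h : int) : 0 < m ->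
    (forall i, 0 <= (vec4 a b e h *m facet_heights m) 0 i) ->
  semigroup_of (deep_simplex R m) (vec4 a b e h) \/
  forall i, 2 * m < (vec4 a b e h *m facet_heights m) 0 i.
Proof.
move=> m0 /int_vec4_heights_ge0P [H0 H1 H2 H3].
have [D|[D0 D1 D2 D3]] := cone_decomposition m0 H0 H1 H2 H3; last first.
  by right=> i; rewrite int_vec4_heights; case: i => [[|[|[|[|//]]]] lt4].
left; have Q_mon : submonoid (semigroup_of (deep_simplex R m)).
  exact: smallest_submonoid.
have gen := @deep_semigroup_generator R m _ _ _ m0.
have [nA [tA [nB [tB [nM [p [x [[nA0 nB0 nM0] []]]]]]]]] := D.
case: nA nA0 => // nA _; case: nB nB0 => // nB _; case: nM nM0 => // nM _.
case: tA => // tA; case: tB => // tB; case: p => // p; case: x => // x.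
move=> tA_le tB_le p_le x_le [-> -> -> ->].
have QA : semigroup_of (deep_simplex R m)
    (vec4 (4 * m * tA) (- tA%:Z) (- 2 * m * tA) nA).
  have -> : vec4 (4 * m * tA) (- tA%:Z) (- 2 * m * tA) nA%:Z =
      vec4 0 0 0 1 *+ nA + vec4 (4 * m) (-1) (- 2 * m) 0 *+ tA + 0 *+ 0.
    by rewrite !vec4Mn !vec4D mulr0n addr0; congr vec4; lia.
  apply: (submonoid_arithmetic_sums (c := 3) (c' := 0)); [by []| |lia|lia].
  move=> i j i3 _; rewrite mul0rn addr0 !vec4Mn vec4D mul0rn addr0.
  by apply: gen; nia.
have QB : semigroup_of (deep_simplex R m) (vec4 0 tB%:Z nB nB).
  have -> : vec4 0 tB%:Z nB nB =
      vec4 0 0 1 1 *+ nB + vec4 0 1 0 0 *+ tB + 0 *+ 0.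
    by rewrite !vec4Mn !vec4D mulr0n addr0; congr vec4; lia.
  apply: (submonoid_arithmetic_sums (c := 1) (c' := 0)); [by []| |lia|lia].
  move=> i j i1 _; rewrite mul0rn addr0 !vec4Mn vec4D !mul0rn !addr0.
  by apply: gen; nia.
have QM : semigroup_of (deep_simplex R m)
    (vec4 (nM%:Z + 2 * p + 4 * m * x) (- x%:Z) (- p%:Z - 2 * m * x) nM).
  have -> : vec4 (nM%:Z + 2 * p + 4 * m * x) (- x%:Z) (- p%:Z - 2 * m * x)
      nM%:Z = vec4 1 0 0 1 *+ nM + vec4 2 0 (-1) 0 *+ p +
              vec4 (4 * m) (-1) (- 2 * m) 0 *+ x.
    by rewrite !vec4Mn !vec4D; congr vec4; lia.
  (* The middle slice has the [m] residues [2 i + 1] and, for each, two positions [j] along [a]. *)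
  apply: (submonoid_arithmetic_sums (c := `|m - 1|%N) (c' := 1));
    [by []| |nia|lia].
  move=> i j im j1; rewrite !vec4Mn !vec4D !mul0rn !addr0.
  by apply: gen; nia.
have -> : vec4 (4 * m * tA + nM + 2 * p + 4 * m * x) (- tA%:Z + tB - x%:Z)
    (- 2 * m * tA + nB - p%:Z - 2 * m * x) (nA%:Z + nB + nM) =
    vec4 (4 * m * tA) (- tA%:Z) (- 2 * m * tA) nA%:Z + vec4 0 tB%:Z nB nB +
    vec4 (nM%:Z + 2 * p + 4 * m * x) (- x%:Z) (- p%:Z - 2 * m * x) nM.
  by rewrite !vec4D; congr vec4; lia.
by case: Q_mon => _ QD; apply: (QD) => //; apply: QD.
Qed.

(* The sums of [h] generators with [h <= 2], together with everything of degree
   above 2, form a submonoid. *)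
Lemma deep_semigroup_height2 (R : realType) (m a b e : int) : 0 < m ->
    semigroup_of (deep_simplex R m) (vec4 a b e 2) ->
  exists q q' : 'rV[int]_3,
    [/\ deep_simplex R m (real_point R q), deep_simplex R m (real_point R q')
      & vec4 a b e 2 = row_mx q 1 + row_mx q' 1].
Proof.
move=> m0; pose ht (q : 'rV[int]_(3 + 1)) := q 0 (@Ordinal 4 3 isT).
pose G := [set row_mx p (1 : 'rV[int]_1)
             | p in [set p | deep_simplex R m (real_point R p)]].
pose S := [set q | [/\ 0 <= ht q, ht q = 0 -> q = 0, ht q = 1 -> G q
  & ht q = 2 -> exists q1 q2, [/\ G q1, G q2 & q = q1 + q2]]].
have htD x y : ht (x + y) = ht x + ht y by rewrite /ht mxE.
have ht0 : ht 0 = 0 by rewrite /ht mxE.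
suff QS : semigroup_of (deep_simplex R m) `<=` S.
  move=> /QS [_ _ _]; case; first by rewrite /ht mxE.
  by move=> _ [_ [[q Pq <-] [q' Pq' <-] ->]]; exists q, q'.
apply: smallest_sub; last first.
  move=> _ [p Pp <-].
  have htp : ht (row_mx p 1) = 1.
    by have [? [? [? ->]]] := row_mx1_vec4 p; rewrite /ht mxE.
  by split; rewrite htp //; exists p.
split; first by split; rewrite ht0.
move=> x y [x0 x_0 x_1 x_2] [y0 y_0 y_1 y_2].
(* A summand of degree 0 is zero; two of positive degree reach total degree 2 only as two
   generators. *)
have [/x_0 xE|hx] : ht x = 0 \/ 1 <= ht x by lia.
  by rewrite xE add0r.
have [/y_0 yE|hy] : ht y = 0 \/ 1 <= ht y by lia.
  by rewrite yE addr0.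
split; rewrite htD; [lia|lia|lia|] => h2.
exists x, y; split=> //; [apply: x_1 | apply: y_1]; lia.
Qed.

Lemma deep_simplex_not_normal (R : realType) (m : int) : 0 < m ->
  ~ normal_semigroup (deep_simplex R m).
Proof.
move=> m0; rewrite /normal_semigroup.
rewrite (normalization_simplicial (deep_cone_of R m0) (deep_group_of R m0)).
move=> QN.
(* This point has [a + 2 e = 3] and residue [2 m + 1], the least odd one that no single middle point
   has. *)
have : semigroup_of (deep_simplex R m) (vec4 (2 * m + 1) 0 (1 - m) 2).
  by rewrite QN /=; apply/int_vec4_heights_ge0P; split; nia.
case/(deep_semigroup_height2 m0) => q [q' [Pq Pq']].
have heights p : deep_simplex R m (real_point R p) ->
    forall i, 0 <= (row_mx p 1 *m facet_heights m) 0 i.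
  move=> Pp; apply: (deep_semigroup_ge0 (R := R) m0).
  by apply: sub_gen_smallest; exists p.
move: {Pq} (heights _ Pq) {Pq'} (heights _ Pq').
have [a [b [e ->]]] := row_mx1_vec4 q.
have [a' [b' [e' ->]]] := row_mx1_vec4 q'.
move=> /int_vec4_heights_ge0P [H0 H1 H2 +].
rewrite mulr1 => H3 /int_vec4_heights_ge0P [H0' H1' H2' +].
rewrite mulr1 vec4D => H3' /vec4_inj [aE bE eE _].
exact: (hole_not_sum m0 H0 H1 H2 H3 H0' H1' H2' H3').
Qed.

Theorem theorem1p1 (R : realType) (k : nat) :
  exists P : set 'rV[R]_3,
    [/\ lattice_polytope P, simplex 3 P, ~ normal_semigroup P
      & forall q : 'rV[int]_(3 + 1), hole P q ->
        forall F : set 'rV[R]_(3 + 1), semigroup_facet P F ->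
          k%:Z <= lattice_height P F q].
Proof.
(* The successor keeps [m] positive for [k = 0]; the depth [2 m] exceeds [k]. *)
pose m : int := k.+1%:Z; have m0 : 0 < m by [].
have coneE := deep_cone_of R m0; have groupE := deep_group_of R m0.
have normE := normalization_simplicial coneE groupE.
exists (deep_simplex R m); split.
- exact: deep_simplex_lattice_polytope.
- exact: deep_simplex_is_simplex.
- exact: deep_simplex_not_normal.
move=> q [Nq Qq] F facetF.
(* Two middle lattice points serve: [vec4 1 0 0 1] has height 1 over the first two facets, and the
   other witness, where [a] and [u] are largest, over the last two. *)
have unit_height (i : 'I_(3 + 1)) : exists2 w,
    normalization (deep_simplex R m) w & (w *m facet_heights m) 0 i = 1.
  rewrite normE; have [i2|i2] := ltnP i 2.
    exists (vec4 1 0 0 1).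
      by apply/int_vec4_heights_ge0P; split; lia.
    by rewrite int_vec4_heights; case: i i2 => [[|[|[|[|//]]]] lt4] //= _; lia.
  exists (vec4 (6 * m - 1) (-1) (1 - 3 * m) 1).
    by apply/int_vec4_heights_ge0P; split; nia.
  by rewrite int_vec4_heights; case: i i2 => [[|[|[|[|//]]]] lt4] //= _; lia.
have [i ->] := lattice_height_simplicial (facet_heights_unit R m0) coneE groupE
  unit_height facetF.
have [a [b [e [h qE]]]] := vec4_eta q; subst q.
move: Nq; rewrite normE => /(deep_semigroup_or_deep R m0) [//|/(_ i)].
by move=> /ltW; apply: le_trans; rewrite /m; lia.
Qed.
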